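(* $$\frac{56\sqrt2}{3}=\sum_{j=0}^{\infty}\left(-\frac14\right)^{j}\frac{\left(\frac18\right)_j\left(\frac58\right)_j\left(\frac34\right)_j}{\left(\frac{11}{12}\right)_j(1)_j\left(\frac{19}{12}\right)_j}\,(40j+27).$$
   Context: $(x)_0=1$ and $(x)_j=x(x+1)\cdots(x+j-1)$ for positive integers $j$ (rising factorial). *)

(* Defs.v *)
From Stdlib Require Import Reals.
Open Scope R_scope.

Fixpoint rising_factorial (x : R) (j : nat) : R :=
  match j with
  | O => 1
  | S k => rising_factorial x k * (x + INR k)
  end.

(* Main.v *)
Require Import Defs.
From Stdlib Require Import Reals Lra Lia.
From Coquelicot Require Import Coquelicot.
Open Scope R_scope.

(** Put [u_n(a) = (-1)^n (a)_2n (b)_n (c)_n (1+a-b-c)_n /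
    (n! (1+a-b)_2n (1+a-c)_2n)].  The series in question is, up to the factor
    112, the case [a = 1/4], [b = 5/12], [c = 1/12] of
    [S(a) = sum_n u_n(a) ((a+3n) -
       (a+2n)(b+n)(c+n) / ((1+a-b+2n)(1+a-c+2n)))],
    which is a Wilf-Zeilberger accelerated form of the well-poised series
    [sum_k (-1)^k (a+2k) (a)_k (b)_k (c)_k / (k! (1+a-b)_k (1+a-c)_k)].
    At these parameters the two factors [b+n], [c+n] split off the cubic
    numerator and leave the linear factor [40n+27] ([summand_quarter]).

    The sum is evaluated by raising [a].  The combination
    [a (1+a-b-c) / ((1+a-b)(1+a-c)) S_n(a+1) - S_n(a)] of summands telescopes
    with primitive [n u_n(a)], which vanishes at [n = 0] and at infinity
    ([summand_telescopes]); hence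
    [S(a) = a (1+a-b-c) / ((1+a-b)(1+a-c)) S(a+1)].  Since [u_n] at least
    halves at each step and [a |u_n(a)|] is at most [2 / 2^n] for [n >= 1],
    [S(a) - a] stays bounded as [a] grows ([Series_summand_asymptotic]).
    Iterating the functional equation therefore writes [S(a)] as the limit of
    [n (a)_n (1+a-b-c)_n / ((1+a-b)_n (1+a-c)_n)], that is, as
    [Gamma(1+a-b) Gamma(1+a-c) / (Gamma(a) Gamma(1+a-b-c))].

    For the parameters above one must show that
    [(1/4)_n (3/4)_n / ((1/6)_n (5/6)_n)] tends to [sqrt 2].  By the
    duplication formula the square of this quotient is
    [2 (g_2n(1/2) / g_n(1/2)) / (g_2n(1/3) / g_n(1/3))^2], where
    [g_n(x) = n (x)_n (1-x)_n / n!^2] ([quarter_sixth_quotient]).  Each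
    [g_n(x)] converges to a positive limit ([reflection_product_cv]), so both
    inner quotients tend to 1. *)

(** * Rising factorials *)

Lemma rising_factorial_pos (x : R) (n : nat) :
  0 < x -> 0 < rising_factorial x n.
Proof.
  intros hx; induction n as [|n IH]; simpl; [lra|].
  apply Rmult_lt_0_compat; [exact IH|].
  pose proof (pos_INR n); lra.
Qed.

Lemma rising_factorial_shift (x : R) (n : nat) :
  x * rising_factorial (x + 1) n = rising_factorial x n * (x + INR n).
Proof.
  induction n as [|n IH]; [simpl; ring|].
  rewrite S_INR; cbn [rising_factorial].
  rewrite <- Rmult_assoc, IH; ring.
Qed.

Lemma rising_factorial_double_S (x : R) (n : nat) :
  rising_factorial x (2 * S n) =
  rising_factorial x (2 * n) * (x + 2 * INR n) * (x + 2 * INR n + 1).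
Proof.
  replace (2 * S n)%nat with (S (S (2 * n))) by lia.
  cbn [rising_factorial]; rewrite S_INR, mult_INR; simpl (INR 2); ring.
Qed.

Lemma rising_factorial_duplication (x : R) (n : nat) :
  rising_factorial (2 * x) (2 * n) =
  4 ^ n * (rising_factorial x n * rising_factorial (x + 1 / 2) n).
Proof.
  induction n as [|n IH]; [simpl; ring|].
  rewrite rising_factorial_double_S, IH; simpl; field.
Qed.

Lemma rising_factorial_shift_div (n : nat) (x y : R) :
  y = x + 1 -> x <> 0 ->
  rising_factorial y n = rising_factorial x n * (x + INR n) / x.
Proof.
  intros -> hx; rewrite <- rising_factorial_shift; field; exact hx.
Qed.

(** * The summand and its telescoping relation *)

(** The WZ primitive of the recurrence in [a] is [n] times this term. *)
Definition hyp_term (b c a : R) (n : nat) : R :=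
  (- 1) ^ n *
  (rising_factorial a (2 * n) * rising_factorial b n * rising_factorial c n *
   rising_factorial (1 + a - b - c) n) /
  (rising_factorial 1 n * rising_factorial (1 + a - b) (2 * n) *
   rising_factorial (1 + a - c) (2 * n)).

(** Over the common denominator the second factor is the cubic
    [(a+3n)(1+a-b+2n)(1+a-c+2n) - (a+2n)(b+n)(c+n)]; the split form shows that
    it lies between 0 and [a+3n]. *)
Definition summand (b c a : R) (n : nat) : R :=
  hyp_term b c a n *
  (a + 3 * INR n -
   (a + 2 * INR n) * (b + INR n) * (c + INR n) /
   ((1 + a - b + 2 * INR n) * (1 + a - c + 2 * INR n))).

(** Up to sign, the quotient of consecutive terms [hyp_term]; the factors are
    paired so that, for [a > 0] and [b], [c] between 0 and 1/2, the first four are at most 1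
    and the last is at most 1/2. *)
Definition term_ratio (b c a : R) (n : nat) : R :=
  (a + 2 * INR n) / (1 + a - b + 2 * INR n) *
  ((a + 2 * INR n + 1) / (2 + a - b + 2 * INR n)) *
  ((b + INR n) / (INR n + 1)) *
  ((1 + a - b - c + INR n) / (1 + a - c + 2 * INR n)) *
  ((c + INR n) / (2 + a - c + 2 * INR n)).

Lemma hyp_term_0 (b c a : R) : hyp_term b c a 0 = 1.
Proof. unfold hyp_term; simpl; field. Qed.

Lemma hyp_term_S (b c a : R) (n : nat) :
  0 <= b <= 1 / 2 -> 0 <= c <= 1 / 2 -> 0 < a -> hyp_term b c a (S n) = - hyp_term b c a n * term_ratio b c a n.
Proof.
  intros hb hc ha; unfold hyp_term, term_ratio.
  rewrite !rising_factorial_double_S.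
  pose proof (pos_INR n).
  pose proof (rising_factorial_pos 1 n).
  pose proof (rising_factorial_pos (1 + a - b) (2 * n)).
  pose proof (rising_factorial_pos (1 + a - c) (2 * n)).
  cbn [rising_factorial pow].
  field; repeat split; lra.
Qed.

(** [a (a+1)_2n = (a)_2n (a+2n)], and likewise for the three other
    rising factorials that contain [a]. *)
Lemma hyp_term_shift (b c a : R) (n : nat) :
  0 <= b <= 1 / 2 -> 0 <= c <= 1 / 2 -> 0 < a ->
  a * (1 + a - b - c) * hyp_term b c (a + 1) n =
  hyp_term b c a n *
  ((a + 2 * INR n) * (1 + a - b - c + INR n) * (1 + a - b) * (1 + a - c) /
   ((1 + a - b + 2 * INR n) * (1 + a - c + 2 * INR n))).
Proof.
  intros hb hc ha; unfold hyp_term.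
  pose proof (pos_INR n).
  pose proof (rising_factorial_pos 1 n).
  pose proof (rising_factorial_pos (1 + a - b) (2 * n)).
  pose proof (rising_factorial_pos (1 + a - c) (2 * n)).
  pose proof (rising_factorial_shift a (2 * n)) as Ha.
  pose proof (rising_factorial_shift (1 + a - b - c) n) as Hbc.
  rewrite mult_INR in Ha; simpl (INR 2) in Ha.
  replace (1 + (a + 1) - b - c) with (1 + a - b - c + 1) by ring.
  rewrite (rising_factorial_shift_div (2 * n) (1 + a - b) (1 + (a + 1) - b)),
    (rising_factorial_shift_div (2 * n) (1 + a - c) (1 + (a + 1) - c))
    by lra.
  rewrite mult_INR; simpl (INR 2).
  set (X := rising_factorial (a + 1) (2 * n)) in *.
  set (Y := rising_factorial (1 + a - b - c + 1) n) in *.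
  transitivity
    ((- 1) ^ n * ((a * X) * rising_factorial b n * rising_factorial c n *
       ((1 + a - b - c) * Y)) /
     (rising_factorial 1 n *
      (rising_factorial (1 + a - b) (2 * n) * (1 + a - b + 2 * INR n) /
       (1 + a - b)) *
      (rising_factorial (1 + a - c) (2 * n) * (1 + a - c + 2 * INR n) /
       (1 + a - c)))).
  - field; repeat split; lra.
  - rewrite Ha, Hbc; field; repeat split; lra.
Qed.

(** After division by [hyp_term b c a n] both sides are rational in [a] and
    [n], and the two ratio lemmas reduce the claim to a polynomial identity. *)
Lemma summand_telescopes (b c a : R) (n : nat) :
  0 <= b <= 1 / 2 -> 0 <= c <= 1 / 2 -> 0 < a ->
  a * (1 + a - b - c) / ((1 + a - b) * (1 + a - c)) * summand b c (a + 1) n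
  - summand b c a n =
  INR (S n) * hyp_term b c a (S n) - INR n * hyp_term b c a n.
Proof.
  intros hb hc ha; unfold summand.
  pose proof (pos_INR n).
  pose proof (hyp_term_shift b c a n hb hc ha) as Hs.
  rewrite (hyp_term_S b c a n hb hc ha), S_INR; unfold term_ratio.
  set (u' := hyp_term b c (a + 1) n) in *.
  set (u := hyp_term b c a n) in *.
  set (k := INR n) in *.
  set (q := _ - _ / _).
  transitivity ((a * (1 + a - b - c) * u') / ((1 + a - b) * (1 + a - c)) * q
    - u * (a + 3 * k - (a + 2 * k) * (b + k) * (c + k) /
       ((1 + a - b + 2 * k) * (1 + a - c + 2 * k)))).
  - field; lra.
  - rewrite Hs; subst q; field; repeat split; lra.
Qed.


(** * Size of the terms *)

Lemma Rdiv_between_0_1 (x y : R) : 0 <= x <= y -> 0 < y -> 0 <= x / y <= 1.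
Proof.
  intros hx hy; split.
  - apply Rdiv_le_0_compat; lra.
  - apply Rle_div_l; lra.
Qed.

Lemma term_ratio_bounds (b c a : R) (n : nat) :
  0 <= b <= 1 / 2 -> 0 <= c <= 1 / 2 -> 0 < a ->
  0 <= term_ratio b c a n <= (c + INR n) / (2 + a - c + 2 * INR n).
Proof.
  intros hb hc ha; unfold term_ratio.
  pose proof (pos_INR n).
  assert (mult_unit : forall x y, 0 <= x <= 1 -> 0 <= y <= 1 -> 0 <= x * y <= 1)
    by (intros x y hx hy; nra).
  assert (hlast : 0 <= (c + INR n) / (2 + a - c + 2 * INR n))
    by (apply Rdiv_le_0_compat; lra).
  match goal with
  | |- 0 <= ?p * ?q <= _ => assert (hp : 0 <= p <= 1)
  end.
  { apply mult_unit; [apply mult_unit; [apply mult_unit|]|];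
      apply Rdiv_between_0_1; lra. }
  nra.
Qed.

Lemma hyp_term_halves (b c a : R) (n : nat) :
  0 <= b <= 1 / 2 -> 0 <= c <= 1 / 2 -> 0 < a ->
  Rabs (hyp_term b c a (S n)) <= Rabs (hyp_term b c a n) / 2.
Proof.
  intros hb hc ha.
  rewrite hyp_term_S, Rabs_mult, Rabs_Ropp by assumption.
  destruct (term_ratio_bounds b c a n hb hc ha) as [h0 h1].
  rewrite (Rabs_pos_eq (term_ratio b c a n)) by exact h0.
  pose proof (pos_INR n).
  assert (h2 : (c + INR n) / (2 + a - c + 2 * INR n) <= 1 / 2)
    by (apply Rle_div_l; lra).
  pose proof (Rabs_pos (hyp_term b c a n)); nra.
Qed.

Lemma hyp_term_bound (b c a : R) (n : nat) :
  0 <= b <= 1 / 2 -> 0 <= c <= 1 / 2 -> 0 < a ->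
  Rabs (hyp_term b c a n) <= / 2 ^ n.
Proof.
  intros hb hc ha; induction n as [|n IH].
  - rewrite hyp_term_0, Rabs_R1; simpl; lra.
  - pose proof (hyp_term_halves b c a n hb hc ha).
    simpl; rewrite Rinv_mult; lra.
Qed.

(** The gain of a factor [1 / a] over [hyp_term_bound] comes from the factor
    [c / (2+a-c)] of the first ratio.  It is what keeps the tail of the sum
    bounded as [a] tends to infinity. *)
Lemma hyp_term_S_bound (b c a : R) (n : nat) :
  0 <= b <= 1 / 2 -> 0 <= c <= 1 / 2 -> 0 < a ->
  a * Rabs (hyp_term b c a (S n)) <= / 2 ^ n.
Proof.
  intros hb hc ha; induction n as [|n IH].
  - rewrite hyp_term_S, hyp_term_0 by assumption.
    destruct (term_ratio_bounds b c a 0 hb hc ha) as [h0 h1].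
    simpl INR in h1.
    assert (h2 : a * ((c + 0) / (2 + a - c + 2 * 0)) <= 1).
    { replace (a * ((c + 0) / (2 + a - c + 2 * 0))) with (a * c / (2 + a - c))
        by (field; lra).
      apply Rle_div_l; nra. }
    replace (- (1) * term_ratio b c a 0) with (- term_ratio b c a 0) by ring.
    rewrite Rabs_Ropp, Rabs_pos_eq by exact h0.
    simpl; nra.
  - pose proof (hyp_term_halves b c a (S n) hb hc ha).
    simpl pow; rewrite Rinv_mult; nra.
Qed.

Lemma summand_factor_bound (b c a : R) (n : nat) :
  0 <= b <= 1 / 2 -> 0 <= c <= 1 / 2 -> 0 < a ->
  Rabs (summand b c a n) <= Rabs (hyp_term b c a n) * (a + 3 * INR n).
Proof.
  intros hb hc ha; unfold summand; rewrite Rabs_mult.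
  pose proof (pos_INR n).
  apply Rmult_le_compat_l; [apply Rabs_pos|].
  assert (hq : 0 <= (b + INR n) / (1 + a - b + 2 * INR n) *
                    ((c + INR n) / (1 + a - c + 2 * INR n)) <= 1).
  { destruct (Rdiv_between_0_1 (b + INR n) (1 + a - b + 2 * INR n)); [lra|lra|].
    destruct (Rdiv_between_0_1 (c + INR n) (1 + a - c + 2 * INR n)); [lra|lra|].
    nra. }
  replace ((a + 2 * INR n) * (b + INR n) * (c + INR n) /
           ((1 + a - b + 2 * INR n) * (1 + a - c + 2 * INR n)))
    with ((a + 2 * INR n) *
          ((b + INR n) / (1 + a - b + 2 * INR n) *
           ((c + INR n) / (1 + a - c + 2 * INR n)))) by (field; lra).
  set (q := _ / _ * _) in *.
  rewrite Rabs_pos_eq; nra.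
Qed.

Lemma summand_bound (b c a : R) (n : nat) :
  0 <= b <= 1 / 2 -> 0 <= c <= 1 / 2 -> 0 < a ->
  Rabs (summand b c a n) <= (a + 3 * INR n) / 2 ^ n.
Proof.
  intros hb hc ha.
  eapply Rle_trans; [apply summand_factor_bound; assumption|].
  unfold Rdiv; rewrite Rmult_comm; apply Rmult_le_compat_l.
  - pose proof (pos_INR n); lra.
  - apply hyp_term_bound; assumption.
Qed.

Lemma summand_S_bound (b c a : R) (n : nat) :
  0 <= b <= 1 / 2 -> 0 <= c <= 1 / 2 -> 1 <= a ->
  Rabs (summand b c a (S n)) <= (4 + 3 * INR n) / 2 ^ n.
Proof.
  intros hb hc ha.
  eapply Rle_trans; [apply summand_factor_bound; lra|].
  assert (ha' : 0 < a) by lra.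
  pose proof (hyp_term_S_bound b c a n hb hc ha') as h.
  pose proof (Rabs_pos (hyp_term b c a (S n))).
  pose proof (pos_INR n).
  rewrite S_INR; unfold Rdiv.
  apply Rle_trans with
    ((4 + 3 * INR n) * (a * Rabs (hyp_term b c a (S n)))); [|nra].
  rewrite (Rmult_comm (4 + 3 * INR n)), (Rmult_comm a), Rmult_assoc.
  apply Rmult_le_compat_l; [assumption|nra].
Qed.

Lemma is_lim_seq_inv_INR : is_lim_seq (fun n => / INR n) 0.
Proof.
  replace (Finite 0) with (Rbar_inv p_infty) by reflexivity.
  apply is_lim_seq_inv; [apply is_lim_seq_INR | easy].
Qed.

Lemma is_lim_seq_affine_geometric (p q : R) :
  is_lim_seq (fun n => (p + q * INR n) / 2 ^ n) 0.
Proof.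
  (* 2^n grows at least quadratically *)
  assert (hquad : forall n, INR n * INR n <= 4 * 2 ^ n).
  { assert (hlin : forall n, INR n + 1 <= 2 * 2 ^ n).
    { induction n as [|n IH]; [simpl; lra|].
      rewrite S_INR; simpl pow; pose proof (pos_INR n); lra. }
    induction n as [|n IH]; [simpl; lra|].
    specialize (hlin n).
    rewrite S_INR; simpl pow; nra. }
  assert (hpow : forall n, 0 < 2 ^ n) by (intros; apply pow_lt; lra).
  pose proof is_lim_seq_inv_INR as hinv.
  assert (hlin : is_lim_seq (fun n => INR n / 2 ^ n) 0).
  { apply is_lim_seq_le_le_loc with (fun _ => 0) (fun n => 4 * / INR n).
    - exists 1%nat; intros n hn.
      assert (0 < INR n) by (apply lt_0_INR; lia).
      split; [apply Rlt_le, Rdiv_lt_0_compat; auto|].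
      apply Rle_div_l; [apply hpow|].
      apply Rmult_le_reg_l with (INR n); [assumption|].
      replace (INR n * (4 * / INR n * 2 ^ n)) with (4 * 2 ^ n) by (field; lra).
      apply hquad.
    - apply is_lim_seq_const.
    - replace (Finite 0) with (Rbar_mult 4 0) by (simpl; f_equal; ring).
      apply is_lim_seq_scal_l, hinv. }
  assert (hgeom : is_lim_seq (fun n => / 2 ^ n) 0).
  { apply is_lim_seq_ext with (fun n => (/ 2) ^ n).
    - intros n; apply pow_inv.
    - apply is_lim_seq_geom; rewrite Rabs_pos_eq; lra. }
  apply is_lim_seq_ext with (fun n => p * / 2 ^ n + q * (INR n / 2 ^ n)).
  - intros n; specialize (hpow n); field; lra.
  - replace (Finite 0) with (Finite (p * 0 + q * 0)) by (f_equal; ring).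
    apply is_lim_seq_plus'; apply is_lim_seq_mult';
      auto using is_lim_seq_const.
Qed.

(** The tail after the index [N] is [(p + 2 q + q N) / 2^N]. *)
Lemma is_series_affine_geometric (p q : R) :
  is_series (fun n => (p + q * INR n) / 2 ^ n) (2 * p + 2 * q).
Proof.
  assert (hsum : forall N, sum_n (fun n => (p + q * INR n) / 2 ^ n) N =
            2 * p + 2 * q - (p + 2 * q + q * INR N) / 2 ^ N).
  { induction N as [|N IH].
    - rewrite sum_O; simpl; field.
    - rewrite sum_Sn, IH, S_INR; unfold plus; simpl.
      field; apply pow_nonzero; lra. }
  change (is_lim_seq (sum_n (fun n => (p + q * INR n) / 2 ^ n)) (2 * p + 2 * q)).
  eapply is_lim_seq_ext; [intros N; symmetry; apply hsum|].
  replace (Finite (2 * p + 2 * q)) with (Finite (2 * p + 2 * q - 0))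
    by (f_equal; ring).
  apply is_lim_seq_minus'; [apply is_lim_seq_const|].
  apply is_lim_seq_affine_geometric.
Qed.

(** * The sum as a function of the parameter *)

Lemma ex_series_summand (b c a : R) :
  0 <= b <= 1 / 2 -> 0 <= c <= 1 / 2 -> 0 < a -> ex_series (summand b c a).
Proof.
  intros hb hc ha.
  apply @ex_series_le with (b := fun n => (a + 3 * INR n) / 2 ^ n).
  - intros n; apply summand_bound; assumption.
  - eexists; apply is_series_affine_geometric.
Qed.

(** Sum [summand_telescopes] over [n]: the boundary term [n u_n(a)] is 0 at
    [n = 0] and tends to 0. *)
Lemma Series_summand_shift (b c a : R) :
  0 <= b <= 1 / 2 -> 0 <= c <= 1 / 2 -> 0 < a ->
  Series (summand b c a) =
  a * (1 + a - b - c) / ((1 + a - b) * (1 + a - c)) *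
  Series (summand b c (a + 1)).
Proof.
  intros hb hc ha.
  set (rho := _ / _).
  assert (ha1 : 0 < a + 1) by lra.
  pose proof (Series_correct _ (ex_series_summand b c a hb hc ha)) as h0.
  pose proof (Series_correct _ (ex_series_summand b c (a + 1) hb hc ha1)) as h1.
  pose proof (is_series_minus _ _ _ _ (is_series_scal_l rho _ _ h1) h0) as hd.
  assert (hpart : forall N,
    sum_n (fun n => minus (rho * summand b c (a + 1) n) (summand b c a n)) N =
    INR (S N) * hyp_term b c a (S N)).
  { assert (hstep : forall n,
      minus (rho * summand b c (a + 1) n) (summand b c a n) =
      INR (S n) * hyp_term b c a (S n) - INR n * hyp_term b c a n)
      by (intros n; exact (summand_telescopes b c a n hb hc ha)).
    induction N as [|N IH].
    - rewrite sum_O, hstep; simpl INR; lra.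
    - rewrite sum_Sn, IH, hstep; exact (Rplus_minus _ _). }
  assert (hzero : is_lim_seq (fun N => INR N * hyp_term b c a N) 0).
  { apply is_lim_seq_abs_0.
    apply is_lim_seq_le_le with (fun _ => 0) (fun n => (0 + 1 * INR n) / 2 ^ n).
    - intros n; split; [apply Rabs_pos|].
      rewrite Rabs_mult, (Rabs_pos_eq (INR n)) by apply pos_INR.
      unfold Rdiv; rewrite Rplus_0_l, Rmult_1_l.
      apply Rmult_le_compat_l; [apply pos_INR|].
      apply hyp_term_bound; assumption.
    - apply is_lim_seq_const.
    - apply is_lim_seq_affine_geometric. }
  assert (hlim : is_lim_seq
    (sum_n (fun n => minus (rho * summand b c (a + 1) n) (summand b c a n))) 0).
  { eapply is_lim_seq_ext; [intros N; symmetry; apply hpart|].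
    apply (is_lim_seq_incr_1 (fun N => INR N * hyp_term b c a N)); exact hzero. }
  change (is_lim_seq
    (sum_n (fun n => minus (rho * summand b c (a + 1) n) (summand b c a n)))
    (rho * Series (summand b c (a + 1)) - Series (summand b c a))) in hd.
  apply is_lim_seq_unique in hd; apply is_lim_seq_unique in hlim.
  rewrite hlim in hd; injection hd; lra.
Qed.

(** The term of index 0 differs from [a] by [a b c / ((1+a-b)(1+a-c)) <= 1];
    the others are dominated, uniformly in [a], by a series of sum 14. *)
Lemma Series_summand_asymptotic (b c a : R) :
  0 <= b <= 1 / 2 -> 0 <= c <= 1 / 2 -> 1 <= a ->
  Rabs (Series (summand b c a) - a) <= 15.
Proof.
  intros hb hc ha.
  assert (ha' : 0 < a) by lra.
  rewrite Series_incr_1 by (apply ex_series_summand; assumption).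
  assert (htail : Rabs (Series (fun n => summand b c a (S n))) <= 14).
  { pose proof (is_series_affine_geometric 4 3) as hg.
    replace 14 with (Series (fun n => (4 + 3 * INR n) / 2 ^ n))
      by (rewrite (is_series_unique _ _ hg); ring).
    eapply Rle_trans; [apply Series_Rabs|apply Series_le].
    - apply @ex_series_le with (b := fun n => (4 + 3 * INR n) / 2 ^ n).
      + intros n; unfold norm; simpl; unfold abs; simpl.
        rewrite Rabs_Rabsolu; apply summand_S_bound; assumption.
      + eexists; exact hg.
    - intros n; split; [apply Rabs_pos|apply summand_S_bound; assumption].
    - eexists; exact hg. }
  assert (hhead : Rabs (summand b c a 0 - a) <= 1).
  { unfold summand; rewrite hyp_term_0; simpl INR.
    replace (1 * _ - a)
      with (- (a / (1 + a - b) * (b * (c / (1 + a - c))))) by (field; lra).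
    rewrite Rabs_Ropp.
    destruct (Rdiv_between_0_1 a (1 + a - b)); [lra|lra|].
    destruct (Rdiv_between_0_1 c (1 + a - c)); [lra|lra|].
    assert (0 <= b * (c / (1 + a - c)) <= 1) by nra.
    rewrite Rabs_pos_eq; nra. }
  replace (_ - a) with
    ((summand b c a 0 - a) + Series (fun n => summand b c a (S n))) by ring.
  eapply Rle_trans; [apply Rabs_triang|lra].
Qed.

Lemma Series_summand_iterated_shift (b c a : R) (n : nat) :
  0 <= b <= 1 / 2 -> 0 <= c <= 1 / 2 -> 0 < a ->
  Series (summand b c a) =
  rising_factorial a n * rising_factorial (1 + a - b - c) n /
  (rising_factorial (1 + a - b) n * rising_factorial (1 + a - c) n) *
  Series (summand b c (a + INR n)).
Proof.
  intros hb hc ha; induction n as [|n IH].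
  - simpl; rewrite Rplus_0_r; field.
  - pose proof (pos_INR n).
    pose proof (rising_factorial_pos (1 + a - b) n).
    pose proof (rising_factorial_pos (1 + a - c) n).
    rewrite IH, (Series_summand_shift b c (a + INR n)) by lra.
    rewrite S_INR; cbn [rising_factorial].
    replace (a + INR n + 1) with (a + (INR n + 1)) by ring.
    field; repeat split; lra.
Qed.

(** After [n] shifts the remaining factor is [S(a+n)], which is equivalent
    to [n]. *)
Lemma is_lim_seq_Series_summand (b c a : R) :
  0 <= b <= 1 / 2 -> 0 <= c <= 1 / 2 -> 0 < a ->
  is_lim_seq (fun n =>
    rising_factorial a n * rising_factorial (1 + a - b - c) n /
    (rising_factorial (1 + a - b) n * rising_factorial (1 + a - c) n) * INR n)
    (Series (summand b c a)).
Proof.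
  intros hb hc ha.
  set (sigma := fun n : nat => Series (summand b c (a + INR n))).
  pose proof is_lim_seq_inv_INR as hinv.
  assert (hsigma : is_lim_seq (fun n => sigma n / INR n) 1).
  { apply is_lim_seq_le_le_loc with (fun n => 1 + (a - 15) * / INR n)
      (fun n => 1 + (a + 15) * / INR n).
    - exists 1%nat; intros n hn.
      assert (1 <= INR n) by (apply (le_INR 1); exact hn).
      assert (hs : Rabs (sigma n - (a + INR n)) <= 15)
        by (apply Series_summand_asymptotic; lra).
      apply Rabs_le_between in hs.
      split.
      + apply Rle_div_r; [lra|].
        replace ((1 + (a - 15) * / INR n) * INR n) with (INR n + (a - 15))
          by (field; lra).
        lra.
      + apply Rle_div_l; [lra|].
        replace ((1 + (a + 15) * / INR n) * INR n) with (INR n + (a + 15))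
          by (field; lra).
        lra.
    - replace (Finite 1) with (Finite (1 + (a - 15) * 0)) by (f_equal; ring).
      apply is_lim_seq_plus'; [apply is_lim_seq_const|].
      apply is_lim_seq_mult'; [apply is_lim_seq_const|exact hinv].
    - replace (Finite 1) with (Finite (1 + (a + 15) * 0)) by (f_equal; ring).
      apply is_lim_seq_plus'; [apply is_lim_seq_const|].
      apply is_lim_seq_mult'; [apply is_lim_seq_const|exact hinv]. }
  apply is_lim_seq_ext_loc with
    (fun n => Series (summand b c a) / (sigma n / INR n)).
  - (* sigma n > 0 once n exceeds the error bound *)
    exists 16%nat; intros n hn.
    assert (hn' : 16 <= INR n)
      by (replace 16 with (INR 16) by (simpl; ring); apply le_INR, hn).
    assert (hs : Rabs (sigma n - (a + INR n)) <= 15)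
      by (apply Series_summand_asymptotic; lra).
    apply Rabs_le_between in hs.
    rewrite (Series_summand_iterated_shift b c a n) by assumption.
    fold (sigma n).
    pose proof (rising_factorial_pos (1 + a - b) n).
    pose proof (rising_factorial_pos (1 + a - c) n).
    field; repeat split; lra.
  - replace (Finite (Series (summand b c a)))
      with (Finite (Series (summand b c a) / 1)) by (f_equal; field).
    apply is_lim_seq_div'; [apply is_lim_seq_const|exact hsigma|lra].
Qed.

(** * A gamma quotient equal to the square root of two *)

(** Converges to [1 / (Gamma(x) Gamma(1-x))], i.e. to [sin(pi x) / pi]. *)
Definition reflection_product (x : R) (n : nat) : R :=
  rising_factorial x n * rising_factorial (1 - x) n * INR n /
  (rising_factorial 1 n * rising_factorial 1 n).

Lemma reflection_product_S (x : R) (n : nat) :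
  (0 < n)%nat ->
  reflection_product x (S n) =
  reflection_product x n * (1 + x * (1 - x) / (INR n * (INR n + 1))).
Proof.
  intros hn; apply lt_0_INR in hn.
  pose proof (rising_factorial_pos 1 n Rlt_0_1).
  unfold reflection_product; rewrite S_INR; cbn [rising_factorial].
  field; repeat split; lra.
Qed.

(** The sequence increases from the index 1 on, and [2 - 1/n] grows at least
    as fast as the product of the ratios, because [x (1-x) <= 1/4]. *)
Lemma reflection_product_cv (x : R) :
  0 < x < 1 ->
  exists l, 0 < l /\ is_lim_seq (reflection_product x) l.
Proof.
  intros hx.
  set (g := fun n => reflection_product x (S n)).
  set (y := x * (1 - x)).
  assert (hy : 0 < y <= 1 / 4)
    by (unfold y; split; [nra|]; pose proof (pow2_ge_0 (x - 1 / 2)); nra).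
  assert (hg0 : g 0%nat = y)
    by (unfold g, reflection_product, y; simpl; field).
  assert (hstep : forall n, g (S n) =
            g n * (1 + y / (INR (S n) * (INR (S n) + 1))))
    by (intros n; apply reflection_product_S; lia).
  assert (hfac : forall n, 0 < y / (INR (S n) * (INR (S n) + 1))).
  { intros n; pose proof (pos_INR n); rewrite S_INR.
    apply Rdiv_lt_0_compat; nra. }
  assert (hge : forall n, y <= g n).
  { induction n as [|n IH]; [lra|].
    rewrite hstep; specialize (hfac n); nra. }
  assert (hincr : forall n, g n <= g (S n)).
  { intros n; rewrite hstep; specialize (hfac n); specialize (hge n); nra. }
  assert (hle : forall n, g n <= y * (2 - / INR (S n))).
  { induction n as [|n IH]; [rewrite hg0; simpl; lra|].
    rewrite hstep; specialize (hfac n).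
    eapply Rle_trans; [apply Rmult_le_compat_r; [lra|exact IH]|].
    rewrite (S_INR (S n)).
    assert (hk : 1 <= INR (S n)) by (rewrite S_INR; pose proof (pos_INR n); lra).
    set (k := INR (S n)) in *.
    rewrite Rmult_assoc; apply Rmult_le_compat_l; [lra|].
    apply Rminus_le_0.
    replace (_ - _) with ((1 - y * (2 - / k)) * / (k * (k + 1)))
      by (field; lra).
    assert (0 < / k) by (apply Rinv_0_lt_compat; lra).
    assert (0 < / (k * (k + 1))) by (apply Rinv_0_lt_compat; nra).
    apply Rmult_le_pos; nra. }
  destruct (ex_finite_lim_seq_incr g (2 * y)) as [l hl].
  - exact hincr.
  - intros n; eapply Rle_trans; [apply hle|].
    assert (0 < / INR (S n)) by (apply Rinv_0_lt_compat, lt_0_INR; lia).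
    nra.
  - exists l; split.
    + apply Rlt_le_trans with y; [lra|].
      exact (is_lim_seq_le _ _ _ _ hge (is_lim_seq_const y) hl).
    + apply is_lim_seq_incr_1; exact hl.
Qed.

Lemma is_lim_seq_double (u : nat -> R) (l : Rbar) :
  is_lim_seq u l -> is_lim_seq (fun n => u (2 * n)%nat) l.
Proof.
  intros hu; apply (is_lim_seq_subseq u l (fun n => (2 * n)%nat)); [|exact hu].
  apply eventually_subseq; intros n; lia.
Qed.

Lemma reflection_product_double_cv (x : R) :
  0 < x < 1 ->
  is_lim_seq
    (fun n => reflection_product x (2 * n) / reflection_product x n) 1.
Proof.
  intros hx.
  destruct (reflection_product_cv x hx) as [l [hl0 hl]].
  replace (Finite 1) with (Finite (l / l)) by (f_equal; field; lra).
  apply is_lim_seq_div'; [apply is_lim_seq_double; exact hl|exact hl|lra].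
Qed.

(** Duplication turns [(1/4)_n (3/4)_n] into [(1/2)_2n] and
    [(1/6)_n (5/6)_n] into [(1/3)_2n (2/3)_2n / ((1/3)_n (2/3)_n)].  Squaring
    makes the first one a reflection product at 1/2; the second already is
    a quotient of reflection products at 1/3. *)
Lemma quarter_sixth_quotient (n : nat) :
  (0 < n)%nat ->
  (rising_factorial (1 / 4) n * rising_factorial (3 / 4) n /
   (rising_factorial (1 / 6) n * rising_factorial (5 / 6) n)) ^ 2 =
  2 * (reflection_product (1 / 2) (2 * n) / reflection_product (1 / 2) n) /
  (reflection_product (1 / 3) (2 * n) / reflection_product (1 / 3) n) ^ 2.
Proof.
  intros hn; apply lt_0_INR in hn.
  unfold reflection_product.
  rewrite mult_INR; simpl (INR 2).
  replace (1 - 1 / 2) with (1 / 2) by field.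
  replace (1 - 1 / 3) with (2 / 3) by field.
  pose proof (rising_factorial_duplication (1 / 4) n) as d1.
  pose proof (rising_factorial_duplication (1 / 6) n) as d2.
  pose proof (rising_factorial_duplication (1 / 3) n) as d3.
  pose proof (rising_factorial_duplication (1 / 2) n) as d4.
  replace (2 * (1 / 4)) with (1 / 2) in d1 by field.
  replace (1 / 4 + 1 / 2) with (3 / 4) in d1 by field.
  replace (2 * (1 / 6)) with (1 / 3) in d2 by field.
  replace (1 / 6 + 1 / 2) with (2 / 3) in d2 by field.
  replace (2 * (1 / 3)) with (2 / 3) in d3 by field.
  replace (1 / 3 + 1 / 2) with (5 / 6) in d3 by field.
  replace (2 * (1 / 2)) with 1 in d4 by field.
  replace (1 / 2 + 1 / 2) with 1 in d4 by field.
  rewrite d1, d2, d3, d4.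
  assert (hpos : forall x, 0 < x -> 0 < rising_factorial x n)
    by (intros x hx; apply rising_factorial_pos, hx).
  pose proof (hpos (1 / 2)); pose proof (hpos 1).
  pose proof (hpos (1 / 3)); pose proof (hpos (2 / 3)).
  pose proof (hpos (1 / 6)); pose proof (hpos (5 / 6)).
  pose proof (pow_lt 4 n).
  field; repeat split; lra.
Qed.

Lemma quarter_sixth_quotient_cv :
  is_lim_seq
    (fun n => rising_factorial (1 / 4) n * rising_factorial (3 / 4) n /
       (rising_factorial (1 / 6) n * rising_factorial (5 / 6) n)) (sqrt 2).
Proof.
  assert (hhalf : 0 < 1 / 2 < 1) by lra.
  assert (hthird : 0 < 1 / 3 < 1) by lra.
  apply reflection_product_double_cv in hhalf, hthird.
  apply is_lim_seq_ext_loc with (fun n => sqrt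
    (2 * (reflection_product (1 / 2) (2 * n) / reflection_product (1 / 2) n) /
     (reflection_product (1 / 3) (2 * n) / reflection_product (1 / 3) n) ^ 2)).
  - exists 1%nat; intros n hn.
    rewrite <- quarter_sixth_quotient by lia.
    apply sqrt_pow2, Rdiv_le_0_compat;
      [apply Rmult_le_pos; apply Rlt_le | apply Rmult_lt_0_compat];
      apply rising_factorial_pos; lra.
  - apply (is_lim_seq_continuous sqrt).
    + apply continuity_pt_sqrt; lra.
    + replace (Finite 2) with (Finite (2 * 1 / (1 * (1 * 1))))
        by (f_equal; field).
      apply is_lim_seq_div'; [| |lra].
      * apply is_lim_seq_mult'; [apply is_lim_seq_const|exact hhalf].
      * apply is_lim_seq_mult'; [exact hthird|].
        apply is_lim_seq_mult'; [exact hthird|apply is_lim_seq_const].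
Qed.

Lemma Series_summand_quarter :
  Series (summand (5 / 12) (1 / 12) (1 / 4)) = sqrt 2 / 6.
Proof.
  assert (hb : 0 <= 5 / 12 <= 1 / 2) by lra.
  assert (hc : 0 <= 1 / 12 <= 1 / 2) by lra.
  assert (ha : 0 < 1 / 4) by lra.
  pose proof (is_lim_seq_Series_summand (5 / 12) (1 / 12) (1 / 4) hb hc ha) as hS.
  replace (1 + 1 / 4 - 5 / 12 - 1 / 12) with (3 / 4) in hS by field.
  replace (1 + 1 / 4 - 5 / 12) with (5 / 6) in hS by field.
  replace (1 + 1 / 4 - 1 / 12) with (7 / 6) in hS by field.
  assert (hinv : is_lim_seq (fun n => / (6 * INR n + 1)) 0).
  { replace (Finite 0) with (Rbar_inv p_infty) by reflexivity.
    apply is_lim_seq_inv; [|easy].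
    apply is_lim_seq_plus with p_infty 1;
      [|apply is_lim_seq_const|reflexivity].
    apply is_lim_seq_le_p_loc with INR; [|apply is_lim_seq_INR].
    exists 0%nat; intros n _; pose proof (pos_INR n); lra. }
  assert (hlim : is_lim_seq (fun n =>
    rising_factorial (1 / 4) n * rising_factorial (3 / 4) n /
    (rising_factorial (5 / 6) n * rising_factorial (7 / 6) n) * INR n)
    (sqrt 2 * (1 / 6 * (1 - 0)))).
  { (* (1/6)_n / (7/6)_n * n = (1 - 1 / (6 n + 1)) / 6 *)
    eapply is_lim_seq_ext; [|apply is_lim_seq_mult';
      [exact quarter_sixth_quotient_cv|
       apply is_lim_seq_mult'; [apply is_lim_seq_const|
         apply is_lim_seq_minus'; [apply is_lim_seq_const|exact hinv]]]].
    intros n; simpl.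
    rewrite (rising_factorial_shift_div n (1 / 6) (7 / 6)) by lra.
    pose proof (rising_factorial_pos (1 / 6) n).
    pose proof (rising_factorial_pos (5 / 6) n).
    pose proof (pos_INR n).
    field; repeat split; lra. }
  apply is_lim_seq_unique in hS; apply is_lim_seq_unique in hlim.
  rewrite hlim in hS; injection hS; lra.
Qed.

(** * The evaluation *)

(** Here [1/4], [5/6] and [7/6] double [1/8], [5/12] and [7/12], so
    duplication cancels [(5/12)_n].  Up to linear factors, [(13/12)_n] cancels
    [(1/12)_n] and [(7/12)_n] is [(19/12)_n]; these linear factors reduce the
    cubic to a multiple of [40n+27]. *)
Lemma summand_quarter (n : nat) :
  112 * summand (5 / 12) (1 / 12) (1 / 4) n =
  (- (1 / 4)) ^ n *
  ((rising_factorial (1 / 8) n * rising_factorial (5 / 8) n *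
    rising_factorial (3 / 4) n) /
   (rising_factorial (11 / 12) n * rising_factorial 1 n *
    rising_factorial (19 / 12) n)) *
  (40 * INR n + 27).
Proof.
  unfold summand, hyp_term.
  replace (1 + 1 / 4 - 5 / 12 - 1 / 12) with (3 / 4) by field.
  replace (1 + 1 / 4 - 5 / 12) with (5 / 6) by field.
  replace (1 + 1 / 4 - 1 / 12) with (7 / 6) by field.
  pose proof (rising_factorial_duplication (1 / 8) n) as d1.
  pose proof (rising_factorial_duplication (5 / 12) n) as d2.
  pose proof (rising_factorial_duplication (7 / 12) n) as d3.
  replace (2 * (1 / 8)) with (1 / 4) in d1 by field.
  replace (1 / 8 + 1 / 2) with (5 / 8) in d1 by field.
  replace (2 * (5 / 12)) with (5 / 6) in d2 by field.
  replace (5 / 12 + 1 / 2) with (11 / 12) in d2 by field.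
  replace (2 * (7 / 12)) with (7 / 6) in d3 by field.
  replace (7 / 12 + 1 / 2) with (13 / 12) in d3 by field.
  rewrite d1, d2, d3.
  rewrite (rising_factorial_shift_div n (1 / 12) (13 / 12)) by lra.
  rewrite (rising_factorial_shift_div n (7 / 12) (19 / 12)) by lra.
  replace (- (1 / 4)) with (- 1 * / 4) by field.
  rewrite Rpow_mult_distr, pow_inv.
  assert (hpos : forall x, 0 < x -> 0 < rising_factorial x n)
    by (intros x hx; apply rising_factorial_pos, hx).
  pose proof (hpos (5 / 12)); pose proof (hpos 1).
  pose proof (hpos (11 / 12)); pose proof (hpos (7 / 12)).
  pose proof (hpos (1 / 12)).
  pose proof (pow_lt 4 n).
  pose proof (pos_INR n).
  field; repeat split; lra.
Qed.

Theorem mainTheorem11 :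
  is_series
    (fun j : nat =>
       (- (1 / 4)) ^ j *
       ((rising_factorial (1 / 8) j * rising_factorial (5 / 8) j *
         rising_factorial (3 / 4) j) /
        (rising_factorial (11 / 12) j * rising_factorial 1 j *
         rising_factorial (19 / 12) j)) *
       (40 * INR j + 27))
    (56 * sqrt 2 / 3).
Proof.
  eapply is_series_ext; [exact summand_quarter|].
  replace (56 * sqrt 2 / 3)
    with (112 * Series (summand (5 / 12) (1 / 12) (1 / 4)))
    by (rewrite Series_summand_quarter; field).
  refine (is_series_scal_l 112 _ _ (Series_correct _ _)).
  apply ex_series_summand; lra.
Qed.
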